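(* Let $X$ be a Banach space and let $T:[0,1]\times X\to X$ be a continuous compact operator. Let $l\ge 1$ be an integer and let $\{F_i\}_{1\le i\le l}$ be a $T$-association, where $F_i:[0,1]\times X\to\mathbb{R}$. Then at least one of the following assertions is true: (i) $T(1,\cdot)$ has a fixed point; (ii) the set $$\left\{(t,x)\in[0,1]\times X \;:\; x=tT(t,x),\ \prod_{i=1}^lF_i(t,x)=0,\ \text{and } F_i(t,x)\le 0 \text{ for all } 1\le i\le l\right\}$$ is nonempty.
   Context: A continuous operator $T:[0,1]\times X\to X$ is compact if it maps bounded sets to precompact (relatively compact) sets. Given a Banach space $X$ and a continuous compact operator $T:[0,1]\times X\to X$, a finite sequence $\{F_i\}_{1\le i\le l}$ ($l\ge1$) of real-valued continuous functions on $[0,1]\times X$ is called a $T$-association if: 1. $F_i(0,0)<0$ for all $1\le i\le l$; 2. the set $\{T(t,x) : (t,x)\in[0,1]\times X,\ F_i(t,x)\le 0 \text{ for all } 1\le i\le l\}$ is bounded in $X$. *)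

(* Defs.v *)
From HB Require Import structures.
From mathcomp Require Import all_boot all_order all_algebra.
From mathcomp Require Import all_classical all_reals all_analysis.

Set Implicit Arguments.
Unset Strict Implicit.
Unset Printing Implicit Defensive.

Import Order.TTheory GRing.Theory Num.Theory.
Import numFieldNormedType.Exports.

Local Open Scope classical_set_scope.
Local Open Scope ring_scope.

(* Maps on [0,1] x X are represented by total maps on R * X whose values
   outside [cylinder X] are never used. *)
Definition cylinder (R : realType) (X : normedModType R) : set (R * X) :=
  `[0, 1] `*` [set: X].

Arguments cylinder {R} X.

Definition compact_operator (R : realType) (X : normedModType R)
    (T : R * X -> X) : Prop :=
  forall B : set (R * X),
    B `<=` cylinder X -> bounded_set B -> precompact (T @` B).

Definition T_association (R : realType) (X : normedModType R)
    (T : R * X -> X) (l : nat) (F : 'I_l -> R * X -> R) : Prop :=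
  [/\ (1 <= l)%N,
      forall i, {within cylinder X, continuous (F i)},
      forall i, F i (0, 0) < 0 &
      bounded_set (T @` [set p | cylinder X p /\ forall i, F i p <= 0])].

(* Main.v *)
Require Import Defs.
From HB Require Import structures.
From mathcomp Require Import all_boot all_order all_algebra.
From mathcomp Require Import all_classical all_reals all_analysis.
From mathcomp Require Import finmap ring lra.

(** The assertion is turned into a fixed point problem on the cylinder
    [0,1] x X itself, which Schauder's theorem settles.

    Suppose (ii) fails.  A solution of x = t T(t,x) with all F_i <= 0 then has
    all F_i < 0; call it good.  So a continuous function phi with values in
    [0,1] can separate the good solutions, where phi = 1, from the points where
    some F_i >= 0, where phi = 0 (see [cutoff]).  Let

      Phi(t,x) = (phi(t,x), phi(t,x) T(t,x)).

    A fixed point of Phi satisfies t = phi(t,x) and x = t T(t,x).  Were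
    phi(t,x) = 0, it would be (0,0); but (0,0) is a good solution, at which phi
    is 1.  So phi(t,x) <> 0, all F_i(t,x) are negative, (t,x) is a good
    solution, and t = phi(t,x) = 1: x is a fixed point of T(1,.).  Since T is
    bounded by some M wherever all F_i <= 0, and phi vanishes elsewhere, Phi
    maps [0,1] x {|x| <= M} into itself; this set is bounded, so T, and hence
    Phi, has precompact image on it.

    Schauder's theorem ([schauder]) follows from Brouwer's by projecting onto
    the convex hull of a finite net of the image, parametrised by a standard
    simplex.

    Brouwer's theorem on the simplex ([brouwer]) follows from a discrete
    statement ([grid_sperner]) about colourings of the points whose barycentric
    coordinates are multiples of 1/N.  Instead of Sperner's lemma, which would
    require a triangulation, it rests on Scarf's lemma ([scarf]): its simplices
    are the sets of points that are dominant for the coordinate orders, and the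
    parity argument uses only these orders, no geometry. *)

Set Implicit Arguments.
Unset Strict Implicit.
Unset Printing Implicit Defensive.

(** * Scarf's lemma *)

(** The function takes one value twice and the others once, so exactly the two
    members of that pair can be dropped.  This is used for the colouring and
    for the map sending an order to the least element of a set. *)
Lemma card_collision (A B : finType) (f : A -> B) (D : {set A}) :
  #|D| = #|f @: D|.+1 -> #|[set a in D | f @: (D :\ a) == f @: D]| = 2.
Proof.
move=> cD.
have /dinjectivePn [a aD [b /andP[/= ba bD] fab]] : ~~ dinjectiveb f D.
  apply/negP => /dinjectiveP/imset_injP.
  by rewrite cD -{1}[#|f @: D|]addn0 -addn1 eqn_add2l.
have fDa : f @: (D :\ a) = f @: D.
  apply/eqP; rewrite finset.eqEsubset imsetS ?finset.subsetDl //=.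
  apply/fintype.subsetP => _ /imsetP[x xD ->].
  have [->|xa] := eqVneq x a; first by rewrite fab imset_f // !inE ba.
  by rewrite imset_f // !inE xa.
have inja : {in D :\ a &, injective f}.
  by apply/imset_injP; rewrite fDa; move: (cardsD1 a D); rewrite aD cD => -[->].
have fDb : f @: (D :\ b) = f @: D.
  apply/eqP; rewrite finset.eqEsubset imsetS ?finset.subsetDl //=.
  apply/fintype.subsetP => _ /imsetP[x xD ->].
  have [->|xb] := eqVneq x b; last by rewrite imset_f // !inE xb.
  by rewrite -fab imset_f // !inE eq_sym ba.
suff -> : [set x in D | f @: (D :\ x) == f @: D] = [set a; b].
  by rewrite cards2 eq_sym ba.
apply/setP => x; rewrite !inE; apply/andP/orP; last first.
  by case=> /eqP->; [rewrite fDa | rewrite fDb].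
move=> [xD /eqP fDx]; have [->|xa] := eqVneq x a; first by left.
have : f x \in f @: (D :\ x) by rewrite fDx imset_f.
move=> /imsetP[y]; rewrite !inE => /andP[yx yD] fxy.
have ya : y = a.
  apply/eqP; apply: contraT => ya.
  by rewrite (inja x y) ?inE ?xa ?ya ?eqxx in yx *.
by right; apply/eqP; apply: inja; rewrite ?inE ?xa ?ba // fxy ya fab.
Qed.

Section Scarf.
(** The vertices V carry one linear order per index, given by the ranks [rk].
    The slack vertex [s i] is least for the order [i] and above all non-slack
    vertices for the other orders: it stands for the facet of the simplex
    opposite to [i].  Thanks to slack vertices every cell, even one that lies
    along the boundary, is a set of [#|I|] vertices. *)
Variables (V I : finType) (rk : I -> V -> nat) (s : I -> V) (c : V -> I).
Hypothesis rk_inj : forall i, injective (rk i).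
Hypothesis s_low : forall i v, rk i (s i) <= rk i v.
Hypothesis s_high :
  forall i j v, i != j -> v \notin codom s -> rk i v < rk i (s j).

(** No vertex is strictly above the minimum of [A] for every order.  Dominant
    sets of cardinal [#|I|] act as the top cells of a triangulation, those of
    cardinal [#|I| - 1] as its walls. *)
Definition dominant (A : {set V}) :=
  [forall v, exists i, forall u in A, rk i v <= rk i u].

Lemma dominantP (A : {set V}) :
  reflect (forall v, exists i, forall u, u \in A -> rk i v <= rk i u)
          (dominant A).
Proof.
apply: (iffP forallP) => h v; have := h v.
  by move/existsP => [i /forall_inP hi]; exists i.
by move=> [i hi]; apply/existsP; exists i; apply/forall_inP.
Qed.

Lemma dominantS (A B : {set V}) : A \subset B -> dominant B -> dominant A.
Proof.
move=> /fintype.subsetP AB /dominantP h; apply/dominantP => v.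
by have [i hi] := h v; exists i => u /AB; exact: hi.
Qed.

(** A wall not lying on the boundary separates two cells.  Every element of a
    dominant set is its least element for some order, so among the [#|D| + 1]
    orders exactly two, by [card_collision], can be released without losing an
    element of [D].  Releasing [k] leaves room for exactly one new vertex: the
    largest for [k] among those above the minima of [D] for all other orders. *)
Lemma card_extensions (D : {set V}) (d0 : V) :
  #|D|.+1 = #|I| -> d0 \in D -> d0 \notin codom s -> dominant D ->
  #|[set v | (v \notin D) && dominant (v |: D)]| = 2.
Proof.
move=> cD d0D d0s /dominantP domD.
pose m i := [arg min_(u < d0 in D) rk i u].
have [mD m_le] : (forall i, m i \in D) /\
    (forall i u, u \in D -> rk i (m i) <= rk i u).
  by split=> i; rewrite /m; case: arg_minnP.
have mE i u : u \in D -> (forall v, v \in D -> rk i u <= rk i v) -> m i = u.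
  by move=> uD hu; apply: (@rk_inj i); apply/eqP; rewrite eqn_leq m_le ?hu.
have imD : m @: [set: I] = D.
  apply/setP => u; apply/imsetP/idP => [[i _ ->] //|uD].
  by have [i hi] := domD u; exists i => //; rewrite (mE i u).
have := @card_collision _ _ m [set: I]; rewrite imD cardsT -cD => /(_ erefl).
set K := [set a in _ | _] => cK.
pose M k v := [forall l, (l != k) ==> (rk l (m l) < rk l v)].
have MP k v : reflect (forall l, l != k -> rk l (m l) < rk l v) (M k v).
  by apply: (iffP forall_inP).
(* The slack vertex makes the set of candidates nonempty: this is where a
   non-slack element of D is required. *)
have Ms k : M k (s k).
  apply/MP => l lk; apply: leq_ltn_trans (m_le l _ d0D) _; exact: s_high.
pose b k := [arg max_(v > s k | M k v) rk k v].
have [bM b_max] : (forall k, M k (b k)) /\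
    (forall k v, M k v -> rk k v <= rk k (b k)).
  by split=> k; rewrite /b; case: arg_maxnP.
have Kim k : k \in K -> m @: ([set: I] :\ k) = D.
  by rewrite inE => /andP[_ /eqP].
have bD k : k \in K -> b k \notin D.
  move=> /Kim kK; apply/negP; rewrite -{1}kK => /imsetP[l].
  rewrite !inE andbT => lk e.
  by have /MP/(_ l lk) := bM k; rewrite e ltnn.
rewrite -cK -(card_in_imset (f := b)); last first.
  move=> k k' kK k'K e; apply/eqP; apply: contraT => kk'.
  have [i hi] := domD (b k); have := hi _ (mD i).
  rewrite leqNgt; have [->|ik] := eqVneq i k.
    by rewrite {1}e; move/MP: (bM k') => ->.
  by move/MP: (bM k) => ->.
congr #|pred_of_set _|; apply/setP => v; rewrite inE.
apply/andP/imsetP => [[vD /dominantP dom]|[k kK ->]]; last first.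
  split; first exact: bD.
  apply/dominantP => v'.
  have [/MP Mv|] := boolP (M k v').
    have [i hi] := domD v'; have ik : i = k.
      apply/eqP; apply: contraT => ik.
      by have := Mv _ ik; rewrite ltnNge hi.
    subst i; exists k => u; rewrite !inE => /orP[/eqP->|]; last exact: hi.
    by apply: b_max; apply/MP.
  move=> /forall_inPn[l lk]; rewrite -leqNgt => hl.
  exists l => u; rewrite !inE => /orP[/eqP->|uD].
    by apply/ltnW/(leq_ltn_trans hl); move/MP: (bM k); exact.
  exact: leq_trans hl (m_le _ _ uD).
(* Conversely v is least in v |: D for some order k, so k is the order that
   was released to make room for v. *)
have [k hk] := dom v.
have other u : u \in D -> exists i, [/\ i != k, m i = u & rk i u <= rk i v].
  move=> uD; have [i hi] := dom u; exists i; split.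
  - apply: contraNneq vD => ik; subst i.
    rewrite (_ : v = u) //; apply: (@rk_inj k); apply/eqP.
    by rewrite eqn_leq hi ?hk // !inE ?eqxx ?uD ?orbT.
  - by apply: mE => // w wD; apply: hi; rewrite !inE wD orbT.
  - by apply: hi; rewrite !inE eqxx.
have imk : m @: ([set: I] :\ k) = D.
  apply/setP => u; apply/imsetP/idP => [[i _ ->] //|/other[i [ik <- _]]].
  by exists i; rewrite // !inE ik.
have injk : {in [set: I] :\ k &, injective m}.
  apply/imset_injP; rewrite imk; move: (cardsD1 k [set: I]).
  by rewrite inE cardsT -cD => -[->].
have Mv : M k v.
  apply/MP => l lk; have [i [ik mi le]] := other _ (mD l).
  have il : i = l by apply: injk => //; rewrite !inE ?ik ?lk.
  subst i; rewrite ltn_neqAle le andbT.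
  by apply: contraNneq vD => /rk_inj <-; exact: mD.
exists k; first by rewrite !inE imk eqxx.
apply: (@rk_inj k); apply/eqP; rewrite eqn_leq b_max //=.
have [i hi] := dom (b k).
have ik : i = k.
  apply/eqP; apply: contraT => ik; have /MP/(_ _ ik) := bM k.
  by rewrite ltnNge hi // inE mD orbT.
by subst i; apply: hi; rewrite !inE eqxx.
Qed.

Hypothesis c_s : forall i, c (s i) = i.

(** A wall made of slack vertices only is on the boundary: the single vertex
    completing it to a cell is the non-slack vertex largest for the one
    order that is left. *)
Lemma card_extensions_slack (i0 : I) (b0 : V) : b0 \notin codom s ->
  #|[set v | (v \notin s @: (~: [set i0])) &&
             dominant (v |: s @: (~: [set i0]))]| = 1.
Proof.
move=> b0s; set D := s @: _.
pose vm := [arg max_(v > b0 | v \notin codom s) rk i0 v].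
have [vms vm_max] : vm \notin codom s /\
    forall v, v \notin codom s -> rk i0 v <= rk i0 vm.
  by rewrite /vm; case: arg_maxnP.
have sD i : i != i0 -> s i \in D by move=> h; rewrite imset_f // !inE.
have notlow b i : b \notin codom s -> ~~ (rk i b <= rk i (s i)).
  move=> bs; apply/negP => h.
  have e : b = s i by apply: (@rk_inj i); apply/eqP; rewrite eqn_leq h s_low.
  by rewrite e codom_f in bs.
apply/eqP/cards1P; exists vm; apply/setP => v; rewrite !inE.
apply/andP/eqP => [[vD /dominantP dom]|->]; last first.
  split.
    apply: contra vms => /imsetP[i _ ->]; exact: codom_f.
  apply/dominantP => w; have [/codomP[i ->]|ws] := boolP (w \in codom s).
    by exists i => u _.
  exists i0 => u; rewrite !inE => /orP[/eqP->|/imsetP[j]]; first exact: vm_max.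
  by rewrite !inE => ji ->; apply/ltnW/s_high; rewrite // eq_sym.
have i0E b i : b \notin codom s ->
    (forall u, u \in v |: D -> rk i b <= rk i u) -> i = i0.
  move=> bs hi; apply/eqP; apply: contraT => ii0.
  have := hi (s i).
  by rewrite (negbTE (notlow _ _ bs)) inE sD ?orbT // => /(_ isT).
have vs : v \notin codom s.
  apply/negP => /codomP[j jE].
  have ji0 : j = i0.
    by apply/eqP; apply: contraNT vD => /sD; rewrite -jE.
  have [i hi] := dom b0; have ii0 := i0E _ _ b0s hi; subst.
  by have := hi (s i0); rewrite (negbTE (notlow _ _ b0s)) !inE eqxx => /(_ isT).
have [i hi] := dom vm; have ii0 := i0E _ _ vms hi; subst i.
apply: (@rk_inj i0); apply/eqP; rewrite eqn_leq vm_max //=.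
by apply: hi; rewrite !inE eqxx.
Qed.

Lemma even_sum (T : finType) (P : pred T) (F : T -> nat) :
  (forall x, P x -> ~~ odd (F x)) -> ~~ odd (\sum_(x | P x) F x).
Proof.
move=> h; elim/big_ind: _ => // x y hx hy.
by rewrite oddD (negbTE hx) (negbTE hy).
Qed.

(** Sperner's double counting.  Fix a colour [i0] and call typed the walls
    whose colours are exactly the others.  A cell has two typed walls, or none,
    unless it has all colours.  A typed wall lies in two cells, or in none if it
    is not dominant, except for the slack wall missing [s i0], which lies in
    one.  If no cell had all colours, the number of incident pairs of a cell and
    a typed wall would be even on the one hand and odd on the other. *)
Lemma scarf (b0 : V) : b0 \notin codom s ->
  exists2 A : {set V}, dominant A & (#|A| == #|I|) && (c @: A == [set: I]).
Proof.
move=> b0s; pose i0 := c b0.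
pose room (A : {set V}) := dominant A && (#|A| == #|I|).
pose typed (D : {set V}) := c @: D == ~: [set i0].
have [/existsP[A /andP[/andP[dA cA] imA]]|none] :=
  boolP [exists A, room A && (c @: A == [set: I])].
  by exists A => //; rewrite cA.
exfalso.
have cI : 0 < #|I| by apply/card_gt0P; exists i0.
have cntL : ~~ odd (\sum_(A | room A) \sum_(v | (v \in A) && typed (A :\ v)) 1).
  apply: even_sum => A rA; rewrite sum1dep_card.
  have [->|[v]] := finset.set_0Vmem [set v | (v \in A) && typed (A :\ v)].
    by rewrite cards0.
  rewrite !inE => /andP[vA tv].
  have imA : c @: A = ~: [set i0].
    apply/eqP; rewrite finset.eqEsubset -{2}(eqP tv) imsetS ?subD1set ?andbT //.
    rewrite -finset.disjoints_subset disjoint_sym disjoints1.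
    apply: contra none => i0A; apply/existsP; exists A; rewrite rA /=.
    rewrite finset.eqEsubset finset.subsetT /=.
    rewrite -(finset.setUCr [set i0]) finset.subUset finset.sub1set i0A /=.
    by rewrite -(eqP tv) imsetS ?subD1set.
  rewrite (_ : [set v | _] =
               [set a in A | c @: (A :\ a) == c @: A]); last first.
    by apply/setP => w; rewrite !inE /typed imA.
  rewrite card_collision //.
  by rewrite imA cardsC1 prednK //; case/andP: rA => _ /eqP.
(* The same pairs, indexed by the wall D and the vertex v completing it. *)
move: cntL; rewrite (exchange_big_dep predT) //=.
under eq_bigr => v _.
  rewrite (reindex_onto (fun D => v |: D) (fun A => A :\ v)) /=; last first.
    by move=> A /andP[_ /andP[vA _]]; rewrite finset.setD1K.
  over.
rewrite (exchange_big_dep predT) //=.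
pose D0 := s @: (~: [set i0]).
pose ext (D : {set V}) :=
  \sum_(v | [&& v \notin D, dominant (v |: D),
      #|D|.+1 == #|I| & typed D]) 1.
have s_inj : injective s by apply: can_inj c_s.
have -> : \sum_D \sum_(v | [&& room (v |: D), (v \in v |: D) &
     typed ((v |: D) :\ v)] && ((v |: D) :\ v == D)) 1 = \sum_D ext D.
  apply: eq_bigr => D _; apply: eq_bigl => v.
  rewrite setU11 /=; have [vD|vD] := boolP (v \in D).
    rewrite [(_ :\ v == D)](_ : _ = false) ?andbF //.
    apply/negbTE/negP => /eqP e; move: vD; rewrite -e !inE eqxx //.
  by rewrite finset.setU1K // eqxx andbT /room cardsU1 vD /= -andbA.
rewrite (bigD1 D0) //= oddD.
have -> : ext D0 = 1.
  rewrite /ext sum1dep_card -[RHS](card_extensions_slack i0 b0s).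
  apply: eq_card => v; rewrite !inE.
  suff -> : (#|D0|.+1 == #|I|) && typed D0 by rewrite !andbT.
  rewrite card_imset // cardsC1 prednK // eqxx /=.
  rewrite /typed /D0 -imset_comp (eq_imset (g := id)) ?imset_id //.
rewrite [odd 1]/= (negbTE (even_sum _)) // => D DD0.
rewrite /ext; have [cD|] := boolP (#|D|.+1 == #|I|); last first.
  by move=> _; rewrite big1 // => v /and4P[].
have [tD|] := boolP (typed D); last first.
  by move=> _; rewrite big1 // => v /and4P[].
under eq_bigl do rewrite !andbT.
rewrite sum1dep_card.
have [dD|ndD] := boolP (dominant D); last first.
  rewrite (_ : [set v | _] = finset.set0) ?cards0 //.
  apply/setP => v; rewrite !inE.
  apply: contraNF ndD => /andP[_]; apply: dominantS; exact: finset.subsetUr.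
have [/existsP[d /andP[dD' ds]]|] := boolP [exists d in D, d \notin codom s].
  by rewrite (card_extensions (eqP cD) dD' ds dD).
move=> /exists_inPn allD; case/eqP: DD0.
apply/setP => u; apply/idP/imsetP => [uD|[i ii0 ->]].
  have := allD _ uD; rewrite negbK => /codomP[i ui].
  exists i => //; rewrite -(eqP tD); apply/imsetP; exists u => //.
  by rewrite ui c_s.
move: ii0; rewrite -(eqP tD) => /imsetP[w wD ->].
by have := allD _ wD; rewrite negbK => /codomP[j wj]; rewrite wj c_s -wj.
Qed.
End Scarf.

(** * Colourings of the grid of a simplex *)

Section Grid.
Variables (n N : nat).
Local Notation I := 'I_n.+1.
Local Notation grid := {b : {ffun I -> 'I_N.+1} | \sum_i b i == N}.

(** Barycentric coordinates, shifted by one so that the slack vertex [i] gets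
    a smaller [i]-th coordinate, and larger other ones, than any grid point. *)
Definition height (i : I) (v : grid + I) : nat :=
  match v with inl b => (val b i).+1 | inr j => if i == j then 0 else N.+2 end.

(** Orders vertices by a coordinate and breaks ties by the enumeration, since
    Scarf's lemma asks for linear orders. *)
Definition grid_rank (i : I) (v : grid + I) : nat :=
  height i v * #|{: grid + I}| + enum_rank v.

Lemma grid_rank_inj i : injective (grid_rank i).
Proof.
move=> v w; rewrite /grid_rank => e.
apply: enum_rank_inj; apply: val_inj => /=.
have := congr1 (modn^~ #|{: grid + I}|) e.
by rewrite !modnMDl !modn_small.
Qed.

Lemma grid_rank_lt i v w :
  height i v < height i w -> grid_rank i v < grid_rank i w.
Proof.
rewrite /grid_rank => h.
apply: (@leq_trans ((height i v).+1 * #|{: grid + I}|)).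
  by rewrite mulSn addnC ltn_add2r.
by apply: leq_trans (leq_addr _ _); rewrite leq_mul2r h orbT.
Qed.

Lemma height_le i v w :
  grid_rank i v <= grid_rank i w -> height i v <= height i w.
Proof. by apply: contraTT; rewrite -!ltnNge; exact: grid_rank_lt. Qed.

Lemma grid_ex (g : I -> nat) :
  \sum_i g i = N -> exists b : grid, forall i, val b i = g i :> nat.
Proof.
move=> gN; have gi i : g i < N.+1 by rewrite ltnS -gN (bigD1 i) //= leq_addr.
have bN : \sum_i [ffun i => Ordinal (gi i)] i == N.
  by apply/eqP; rewrite -[RHS]gN; apply: eq_bigr => i _; rewrite ffunE.
by exists (exist _ [ffun i => Ordinal (gi i)] bN) => i; rewrite /= ffunE.
Qed.

(** In units of [1/N], the [x'] are within [n] of [x], and every colour [i] is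
    taken by one of them unless [x] is within [n] of the facet opposite to [i].
    All points are taken in a dominant set [A] having all colours.  If [J] is
    the set of indices whose slack vertex is not in [A], dominance says that no
    grid point exceeds all minima [m i i], [i] in [J], of the coordinates over
    [A]; hence the sum of the [m i i + 1] is more than [N] and every point of [A]
    has coordinates above these minima by at most [n] in total. *)
Lemma grid_sperner (c : grid -> I) :
  exists x : grid, forall i, exists x' : grid,
    (forall j, val x j <= val x' j + n /\ val x' j <= val x j + n) /\
    (c x' = i \/ val x i <= n).
Proof.
pose c' v := match v : grid + I with inl b => c b | inr j => j end.
have [b0 _] : exists b : grid,
    forall i, val b i = (if i == ord0 then N else 0) :> nat.
  by apply: grid_ex; rewrite -big_mkcond big_pred1_eq.
have notslack (b : grid) : inl b \notin codom (@inr grid I).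
  by apply/negP => /codomP[].
have low i v : grid_rank i (inr i) <= grid_rank i v.
  have [->//|vi] := eqVneq v (inr i); apply/ltnW/grid_rank_lt => /=.
  rewrite eqxx; case: v vi => [//|j] /=.
  by rewrite [i == j]eq_sym (inj_eq inr_inj) => /negbTE->.
have high i j v : i != j -> v \notin codom (@inr grid I) ->
    grid_rank i v < grid_rank i (inr j).
  move=> ij; case: v => [b _|k]; last by rewrite codom_f.
  by apply: grid_rank_lt; rewrite /= (negbTE ij) ltnS ltn_ord.
have [A /dominantP domA /andP[_ /eqP imA]] :=
  scarf grid_rank_inj low high (c := c') (fun=> erefl) (notslack b0).
pose J i := inr i \notin A.
have dom (b : grid) :
    exists i, J i /\ forall x, inl x \in A -> val b i <= val x i.
  have [i hi] := domA (inl b); exists i; split.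
    by apply/negP => /hi/height_le /=; rewrite eqxx.
  by move=> x /hi/height_le /=; rewrite ltnS.
have colour i : J i -> exists2 x, inl x \in A & c x = i.
  move=> Ji; have /imsetP[[x|j] vA e] : i \in c' @: A by rewrite imA inE.
    by exists x.
  by move: Ji; rewrite /J e vA.
have [j0 [Jj0 _]] := dom b0; have [x0 x0A _] := colour _ Jj0.
pose m (i : I) := [arg min_(x < x0 | inl x \in A) val x i].
have [mA m_le] : (forall i, inl (m i) \in A) /\
    (forall i x, inl x \in A -> val (m i) i <= val x i).
  by split=> i; rewrite /m; case: arg_minnP.
pose l i := if J i then nat_of_ord (val (m i) i) else 0.
have l_le x : inl x \in A -> forall i, l i <= val x i.
  by move=> xA i; rewrite /l; case: ifP => // _; exact: m_le.
have gN (x : grid) : \sum_i val x i = N by apply/eqP; exact: (valP x).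
(* Otherwise the m i i + 1 could be completed to a grid point, all the slack
   going to the coordinate j0, and this point would not be dominated. *)
have big : N < \sum_(i | J i) (val (m i) i).+1.
  rewrite ltnNge; apply/negP => le.
  pose g i := if J i then
    (val (m i) i).+1 +
    (if i == j0 then N - \sum_(i | J i) (val (m i) i).+1 else 0)
    else 0.
  have [|b hb] := @grid_ex g.
    rewrite -big_mkcond big_split /= -big_mkcondr /=.
    rewrite [X in _ + X](big_pred1 j0) ?subnKC // => i.
    by rewrite /=; case: eqP => [->|]; rewrite ?andbT ?andbF.
  have [i [Ji hi]] := dom b; have := hi _ (mA i).
  by rewrite hb /g Ji addSn ltnNge leq_addr.
have x_le x : inl x \in A -> forall i, val x i <= l i + n.
  move=> xA i; rewrite -leq_subLR.
  have : \sum_j (val x j - l j) <= n.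
    rewrite -(leq_add2l (\sum_j l j)) -big_split /=.
    rewrite (eq_bigr (fun j => nat_of_ord (val x j))) => [|j _]; last first.
      by rewrite subnKC ?l_le.
    rewrite gN -ltnS -addnS (leq_trans big) //.
    under eq_bigr do rewrite -addn1.
    rewrite big_split /= -big_mkcond leq_add2l sum1_card.
    by rewrite -[leqRHS]card_ord max_card.
  by apply: leq_trans; rewrite (bigD1 i) //= leq_addr.
have near x x' : inl x \in A -> inl x' \in A ->
    forall j, val x j <= val x' j + n.
  by move=> xA x'A j; rewrite (leq_trans (x_le _ xA j)) // leq_add2r l_le.
exists x0 => i; have [Ji|Ji] := boolP (J i).
  have [x xA cx] := colour _ Ji; exists x; split; last by left.
  by move=> j; split; apply: near.
exists x0; split; first by move=> j; split; apply: near.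
by right; have := x_le _ x0A i; rewrite /l (negbTE Ji).
Qed.
End Grid.

Import Order.TTheory GRing.Theory Num.Theory.
Import numFieldNormedType.Exports.

Local Open Scope classical_set_scope.
Local Open Scope ring_scope.

(** * Brouwer's theorem on the standard simplex *)

(** The sets of [e]-approximate points generate a filter on [K], and its
    cluster points play the role of limits of subsequences. *)
Lemma compact_approx (R : realType) (T : topologicalType) (K : set T)
    (P : R -> T -> Prop) : compact K ->
  (forall d e x, d <= e -> P d x -> P e x) ->
  (forall e, 0 < e -> exists2 x, K x & P e x) ->
  exists2 a, K a &
    forall U e, nbhs a U -> 0 < e -> exists x, [/\ K x, U x & P e x].
Proof.
move=> Kc Pmono Pex.
pose F := filter_from [set e : R | 0 < e] (fun e => K `&` P e).
have FF : ProperFilter F.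
  apply: filter_from_proper => [|e /Pex[x Kx Px]]; last by exists x.
  apply: filter_from_filter => [|d e d0 e0]; first by exists 1 => /=.
  exists (Num.min d e); first by rewrite /= lt_min d0.
  move=> x [Kx Px]; split; split=> //; apply: Pmono Px.
    by rewrite ge_min lexx.
  by rewrite ge_min lexx orbT.
have [|a [Ka aF]] := Kc F FF; first by exists 1 => //= x [].
exists a => // U e aU e0.
have [|x [[Kx Px] Ux]] := aF (K `&` P e) U _ aU; first by exists e.
by exists x.
Qed.

Lemma within_continuous_near (R : realType) (T : topologicalType)
    (U : normedModType R) (A : set T) (f : T -> U) x e :
  {within A, continuous f} -> A x -> 0 < e ->
  \forall y \near x, A y -> `|f x - f y| < e.
Proof.
move=> /subspace_continuousP fc Ax e0; have /cvgrPdist_lt/(_ _ e0) := fc _ Ax.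
exact.
Qed.

Section Brouwer.
Variables (R : realType) (n : nat).

Definition simplex : set 'rV[R]_n.+1 :=
  [set x | (forall i, 0 <= x 0 i) /\ \sum_i x 0 i = 1].

Lemma simplex_le1 x i : simplex x -> x 0 i <= 1.
Proof.
by move=> [x0 <-]; rewrite (bigD1 i) //= lerDl sumr_ge0.
Qed.

Lemma simplex_compact : compact simplex.
Proof.
have cc := @rV_compact R n.+1 (fun=> `[0, 1]%classic)
                       (fun=> @segment_compact R 0 1).
apply: (subclosed_compact _ cc) => [|x Dx i /=]; last first.
  by rewrite in_itv /= Dx.1 simplex_le1.
have -> : simplex =
    \bigcap_i ((fun x : 'rV[R]_n.+1 => x 0 i) @^-1` [set y | 0 <= y]) `&`
    (fun x : 'rV[R]_n.+1 => \sum_i x 0 i) @^-1` [set 1].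
  apply/seteqP; split=> x [x0 x1]; split=> //= i; last exact: x0.
  by move=> _; exact: x0.
apply: closedI.
  apply: closed_bigI => i _; apply: closed_comp; last exact: closed_ge.
  by move=> x _; exact: coord_continuous.
apply: closed_comp; last exact: closed_eq.
move=> x _; apply: continuous_big => [|i _]; first exact: add_continuous.
exact: coord_continuous.
Qed.

(** A grid point [b] is coloured by an index whose coordinate [f] does not
    decrease; there is one because both [b] and [f b] have coordinates of
    sum 1.  Near a facet the same inequality holds up to [e] for the opposite
    index, because that coordinate is small. *)
Lemma brouwer_approx (f : 'rV[R]_n.+1 -> 'rV[R]_n.+1) :
  (forall x, simplex x -> simplex (f x)) ->
  forall e, 0 < e -> exists2 x, simplex x &
    forall i, exists x', [/\ simplex x', forall j, `|x 0 j - x' 0 j| <= e &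
       x' 0 i <= f x' 0 i + e].
Proof.
move=> fD e e0.
(* So that n / N <= e. *)
pose N := (Num.bound (n%:R / e)).+1.
have N0 : 0 < N%:R :> R by rewrite ltr0n.
have nN : n%:R / N%:R <= e.
  rewrite ler_pdivrMr // mulrC -ler_pdivrMr //.
  apply/ltW/(lt_le_trans (archi_boundP _)); first by rewrite divr_ge0 // ltW.
  by rewrite ler_nat.
pose pt (b : {b : {ffun 'I_n.+1 -> 'I_N.+1} | (\sum_i b i)%N == N})
  : 'rV[R]_n.+1 := \row_i ((val b i)%:R / N%:R).
have ptD b : simplex (pt b).
  split=> [i|]; first by rewrite mxE divr_ge0.
  under eq_bigr do rewrite mxE.
  by rewrite -mulr_suml -natr_sum (eqP (valP b)) divff ?gt_eqF.
pose c b := odflt ord0 [pick i | pt b 0 i <= f (pt b) 0 i].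
have cP b : pt b 0 (c b) <= f (pt b) 0 (c b).
  rewrite /c; case: pickP => //= none; exfalso.
  have : \sum_i f (pt b) 0 i < \sum_i pt b 0 i.
    apply: ltr_sum => [|i _]; last by rewrite ltNge none.
    by apply/hasP; exists ord0; rewrite ?mem_index_enum.
  by rewrite (ptD b).2 (fD _ (ptD b)).2 ltxx.
have [x hx] := grid_sperner c.
exists (pt x) => // i; have [x' [xx' cx]] := hx i.
have ee (a b : nat) : (a <= b + n)%N -> a%:R / N%:R - b%:R / N%:R <= e.
  move=> ab; apply: le_trans nN; rewrite -mulrBl; apply: ler_wpM2r.
    by rewrite invr_ge0.
  by rewrite lerBlDr -natrD ler_nat addnC.
case: cx => [cx|xi].
  exists (pt x'); split=> // [j|].
    have [h1 h2] := xx' j; rewrite !mxE ler_norml.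
    by rewrite ee // andbT lerNl opprB ee.
  by rewrite -cx (le_trans (cP _)) // lerDl ltW.
exists (pt x); split=> // [j|]; first by rewrite subrr normr0 ltW.
have [fx0 _] := fD _ (ptD x).
apply: (@le_trans _ _ e); last by rewrite lerDr.
have := ee (val x i) 0%N; rewrite mul0r subr0 mxE; exact.
Qed.

(** At an accumulation point of the approximations no coordinate is decreased
    by [f], and the coordinates have the same sum before and after. *)
Theorem brouwer (f : 'rV[R]_n.+1 -> 'rV[R]_n.+1) :
  {within simplex, continuous f} ->
  (forall x, simplex x -> simplex (f x)) ->
  exists2 x, simplex x & f x = x.
Proof.
move=> fc fD.
pose P e (x : 'rV[R]_n.+1) := forall i, exists x', [/\ simplex x',
  forall j, `|x 0 j - x' 0 j| <= e & x' 0 i <= f x' 0 i + e].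
have [||a Da aP] := @compact_approx R _ _ P simplex_compact.
- move=> d e x de dx i; have [x' [Dx' h1 h2]] := dx i.
  exists x'; split=> // [j|]; first exact: le_trans de.
  by rewrite (le_trans h2) // lerD2l.
- exact: brouwer_approx.
have fa i : a 0 i <= f a 0 i.
  rewrite leNgt; apply/negP => lt.
  pose h := (a 0 i - f a 0 i) / 4.
  have h0 : 0 < h by rewrite /h; lra.
  have := within_continuous_near fc Da h0 => /nbhs_ballP[d /= d0 dP].
  pose r := Num.min (d / 4) h.
  have r0 : 0 < r by rewrite lt_min h0 divr_gt0.
  have rd : r <= d / 4 by rewrite ge_min lexx.
  have rh : r <= h by rewrite ge_min lexx orbT.
  have [|x [_ [_ xa] /(_ i)[x' [Dx' xx' hx']]]] := aP (ball a r) r _ r0.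
    exact: nbhsx_ballx.
  have near j : `|a 0 j - x' 0 j| <= r + r.
    rewrite -(subrKA (x 0 j)) (le_trans (ler_normD _ _)) // lerD //.
    exact/ltW/(xa 0 j).
  have : ball (f a) h (f x').
    rewrite -ball_normE /=; apply: dP => //; split=> // k j; rewrite ord1.
    by apply: (le_lt_trans (near j)); lra.
  move=> [_ /(_ 0 i)]; have := near i; rewrite /ball /= ltr_norml ler_norml.
  move: hx'; rewrite /h; rewrite /h in rh; lra.
exists a => //; apply/rowP => i; apply/eqP.
have : \sum_j (f a 0 j - a 0 j) == 0.
  by rewrite sumrB (fD _ Da).2 Da.2 subrr.
rewrite psumr_eq0 => [/allP/(_ i)|j _]; last by rewrite subr_ge0.
by rewrite mem_index_enum subr_eq0; apply.
Qed.
End Brouwer.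

(** * Schauder's theorem *)

Lemma cvg_max0 (R : realType) (T : Type) (F : set_system T) (f : T -> R) a :
  Filter F -> f x @[x --> F] --> a ->
  Num.max 0 (f x) @[x --> F] --> Num.max 0 a.
Proof.
move=> FF fa; apply: cvg_comp fa _.
by apply: (@continuous_max R R (cst 0) id); [exact: cvg_cst | exact: cvg_id].
Qed.

Lemma within_comp (T U V : topologicalType) (A : set T) (B : set U)
    (f : T -> U) (g : U -> V) :
  continuous f -> (forall x, A x -> B (f x)) -> {within B, continuous g} ->
  {within A, continuous (g \o f)}.
Proof.
move=> fc AB /subspace_continuousP gc; apply/subspace_continuousP => x Ax.
move=> P /(gc _ (AB _ Ax)) /fc h; apply: (@filterS _ (nbhs x) _ _ _ _ h).
by move=> y hy /AB; exact: hy.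
Qed.

Lemma cvg_row (R : realType) (T : Type) (F : set_system T) n
    (f : T -> 'rV[R]_n) (a : 'rV[R]_n) :
  Filter F -> (forall i, f x 0 i @[x --> F] --> a 0 i) -> f x @[x --> F] --> a.
Proof.
move=> FF fa; apply/cvg_ballP => e e0.
have : \forall x \near F, forall i, ball (a 0 i) e (f x 0 i).
  by apply: filter_forall => i; move/cvg_ballP: (fa i) => /(_ _ e0).
by apply: filterS => x h; split=> // i j; rewrite ord1.
Qed.

Section Schauder.
Variables (R : realType) (E : normedModType R) (C : set E).
Hypothesis C_convex : forall x y t, C x -> C y -> 0 <= t <= 1 ->
  C (t *: x + (1 - t) *: y).

(** By induction on the index set, for weights of arbitrary positive sum, so
    that the partial sums can be renormalised. *)
Lemma convex_sum n (x : 'rV[R]_n.+1) (y : 'I_n.+1 -> E) :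
  simplex x -> (forall i, C (y i)) -> C (\sum_i x 0 i *: y i).
Proof.
move=> [x0 x1] Cy.
suff h (r : seq 'I_n.+1) : 0 < \sum_(i <- r) x 0 i ->
    C ((\sum_(i <- r) x 0 i)^-1 *: \sum_(i <- r) x 0 i *: y i).
  by have := h (index_enum _); rewrite x1 invr1 scale1r; apply.
elim: r => [|i r IH]; first by rewrite big_nil ltxx.
rewrite !big_cons; set s := \sum_(j <- r) x 0 j; set v := \sum_(j <- r) _.
move=> is0.
have s_ge0 : 0 <= s by apply: sumr_ge0.
have [s0|s0] := eqVneq s 0.
  have -> : v = 0.
    rewrite /v big_seq big1 // => j jr; have /eqP := s0.
    rewrite psumr_eq0 // => /allP/(_ j jr)/= /eqP ->; exact: scale0r.
  rewrite s0 !addr0 scalerA mulVf ?scale1r //.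
  by move: is0; rewrite s0 addr0 => /gt_eqF->.
have -> : (x 0 i + s)^-1 *: (x 0 i *: y i + v) =
    (x 0 i / (x 0 i + s)) *: y i + (1 - x 0 i / (x 0 i + s)) *: (s^-1 *: v).
  have n0 : x 0 i + s != 0 by rewrite gt_eqF.
  rewrite scalerDr !scalerA; congr (_ *: _ + _ *: _); first by rewrite mulrC.
  by field; rewrite n0 s0.
apply: C_convex => //; first by apply: IH; rewrite lt_neqAle eq_sym s0.
by rewrite (divr_ge0 (x0 i) (ltW is0)) ler_pdivrMr // mul1r lerDl.
Qed.

Variable Phi : E -> E.
Hypothesis C_ex : C !=set0.
Hypothesis C_closed : closed C.
Hypothesis Phi_cont : {within C, continuous Phi}.
Hypothesis Phi_C : forall x, C x -> C (Phi x).
Hypothesis Phi_compact : precompact (Phi @` C).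

Lemma closure_imageC : closure (Phi @` C) `<=` C.
Proof.
rewrite [X in _ `<=` X](closure_id C).1 //.
by apply: closure_subset => _ [x Cx <-]; exact: Phi_C.
Qed.

(** Schauder projection: for a finite [e]-net [y] of the image, the weights
    [mu i z = max 0 (e - |y i - z|)] move each [z] of the image by at most [e]
    to a convex combination of the net.  Reading off the normalised weights of
    [Phi (p x)], with [p x] the combination of the net with coefficients [x],
    gives a self-map of the simplex, and a Brouwer fixed point [x] of it yields
    the approximate fixed point [p x] of [Phi]. *)
Lemma schauder_approx e : 0 < e -> exists2 x, C x & `|x - Phi x| <= e.
Proof.
move=> e0.
have PhiK x : C x -> closure (Phi @` C) (Phi x).
  by move=> Cx; apply: subset_closure; exists x.
have := Phi_compact; rewrite precompactE compact_cover.
move=> /(_ E (closure (Phi @` C)) (fun y => ball y e)) [||D' D'K D'cov].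
- by move=> y _; exact: ball_open.
- by move=> y Ky; exists y => //; exact: ballxx.
have [s [sC s_cov]] : exists s : seq E, (forall y, y \in s -> C y) /\
    forall z, closure (Phi @` C) z -> exists2 y, y \in s & ball y e z.
  exists (enum_fset D'); split=> [y /D'K|z /D'cov [y /= yD yz]].
    by move=> /set_mem; exact: closure_imageC.
  by exists y.
have s0 : (0 < size s)%N.
  have [x /PhiK/s_cov[y]] := C_ex; by case: (s).
case: s s0 sC s_cov => // y0 s' _; set s := y0 :: s' => sC s_cov.
pose n := size s'.
pose y (i : 'I_n.+1) := nth y0 s i.
have Cy i : C (y i) by apply: sC; apply: mem_nth; exact: ltn_ord.
pose mu i z := Num.max 0 (e - `|y i - z|).
have mu0 i z : 0 <= mu i z by rewrite le_max lexx.
have mu_gt0 z : closure (Phi @` C) z -> 0 < \sum_i mu i z.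
  move=> /s_cov[w ws]; rewrite -ball_normE /= => wz.
  have wi : (index w s < n.+1)%N by rewrite index_mem.
  rewrite (bigD1 (Ordinal wi)) //= ltr_wpDr ?sumr_ge0 //.
  by rewrite /mu /y /= nth_index // lt_max subr_gt0 wz orbT.
pose p (x : 'rV[R]_n.+1) := \sum_i x 0 i *: y i.
have pC x : simplex x -> C (p x) by move=> Dx; exact: convex_sum.
have p_cont : continuous p.
  apply: continuous_big => [|i _ x]; first exact: add_continuous.
  apply: (@cvgZr_tmp _ _ _ (nbhs x)).
  exact: (@coord_continuous R 1 n.+1 0 i x).
pose g x : 'rV[R]_n.+1 :=
  \row_i (mu i (Phi (p x)) / \sum_j mu j (Phi (p x))).
have [x Dx gx] : exists2 x, simplex x & g x = x.
  apply: brouwer => [|x Dx]; last first.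
    have S0 := mu_gt0 _ (PhiK _ (pC _ Dx)).
    split=> [i|]; first by rewrite mxE divr_ge0 // ltW.
    under eq_bigr do rewrite mxE.
    by rewrite -mulr_suml divff ?gt_eqF.
  apply/subspace_continuousP => x Dx.
  have /subspace_continuousP/(_ _ Dx) := within_comp p_cont pC Phi_cont.
  set F := within _ _ => Fp.
  have S0 := mu_gt0 _ (PhiK _ (pC _ Dx)).
  have mu_cvg i : mu i (Phi (p z)) @[z --> F] --> mu i (Phi (p x)).
    apply: cvg_max0; apply: cvgB; first exact: cvg_cst.
    by apply: cvg_norm; apply: cvgB; first exact: cvg_cst.
  apply: cvg_row => i; rewrite mxE; under eq_cvg do rewrite mxE.
  apply: cvgM => //; apply: cvgV; first by rewrite gt_eqF.
  by apply: cvg_big => // ; exact: add_continuous.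
exists (p x); first exact: pC.
have S0 := mu_gt0 _ (PhiK _ (pC _ Dx)).
have -> : p x - Phi (p x) = \sum_i x 0 i *: (y i - Phi (p x)).
  under [RHS]eq_bigr do rewrite scalerBr.
  by rewrite sumrB -scaler_suml Dx.2 scale1r.
rewrite (le_trans (ler_norm_sum _ _ _)) //.
rewrite -[leRHS]mul1r -Dx.2 mulr_suml ler_sum // => i _.
rewrite normrZ ger0_norm; last exact: Dx.1.
have [->|xi0] := eqVneq (x 0 i) 0; first by rewrite !mul0r.
apply: ler_wpM2l; first exact: Dx.1.
rewrite leNgt; apply: contra xi0 => ei.
rewrite -gx mxE /mu (max_idPl _) ?mul0r //.
by rewrite subr_le0 ltW.
Qed.

(** The images of the approximate fixed points accumulate in the compact
    closure of the image, hence so do the approximate fixed points. *)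
Theorem schauder : exists2 x, C x & Phi x = x.
Proof.
pose P e z := exists x, [/\ C x, Phi x = z & `|x - z| <= e].
have := Phi_compact; rewrite precompactE => /(@compact_approx R _ _ P).
case=> [d e z de [x [Cx xz xd]]|e /schauder_approx[x Cx xe]|a Ka aP].
- by exists x; split=> //; exact: le_trans de.
- exists (Phi x); first by apply: subset_closure; exists x.
  by exists x.
have Ca := closure_imageC Ka; exists a => //.
apply/eqP; rewrite -subr_eq0 -normr_le0; apply/ler_addgt0Pl => h h0.
rewrite addr0.
have h2 : 0 < h / 2 by rewrite divr_gt0.
have := within_continuous_near Phi_cont Ca h2 => /nbhs_ballP[d /= d0 dP].
pose r := Num.min (d / 2) (h / 2).
have r0 : 0 < r by rewrite lt_min h2 divr_gt0.
have rd : r <= d / 2 by rewrite ge_min lexx.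
have rh : r <= h / 2 by rewrite ge_min lexx orbT.
have [|z [_ za [x [Cx xz xr]]]] := aP (ball a r) r _ r0.
  exact: nbhsx_ballx.
move: za; rewrite -ball_normE /= => za.
have xa : `|a - x| < d.
  rewrite -(subrKA z) (le_lt_trans (ler_normD _ _)) // (distrC z x); lra.
have : `|Phi a - Phi x| < h / 2 by apply: dP => //; rewrite -ball_normE.
rewrite xz => h1; rewrite -(subrKA z) (le_trans (ler_normD _ _)) //.
rewrite (distrC z a); lra.
Qed.
End Schauder.

(** * The cutoff function and the continuation principle *)

Section Cutoff.
Variables (R : realType) (X : normedModType R) (T : R * X -> X).
Variables (l : nat) (F : 'I_l -> R * X -> R).

(** [depth] is positive exactly where all the [F i] are negative, [excess]
    vanishes exactly where all are nonpositive, and [defect] vanishes exactly at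
    the solutions of [x = t T(t,x)].  Hence [cutoff] is 1 at the solutions with
    all [F i < 0] and 0 wherever some [F i >= 0]; its denominator vanishes only
    at the points of assertion (ii). *)
Definition depth p := \prod_(i < l) Num.max 0 (- F i p).
Definition excess p := \sum_(i < l) Num.max 0 (F i p).
Definition defect p : R := `|p.2 - p.1 *: T p|.
Definition cutoff p := depth p / (depth p + excess p + defect p).

Lemma depth_ge0 p : 0 <= depth p.
Proof. by apply: prodr_ge0 => i _; rewrite le_max lexx. Qed.

Lemma excess_ge0 p : 0 <= excess p.
Proof. by apply: sumr_ge0 => i _; rewrite le_max lexx. Qed.

Lemma depth_neq0 p : depth p != 0 <-> forall i, F i p < 0.
Proof.
split=> [/prodf_neq0 h i|h].
  have := h i isT; apply: contraNT; rewrite -leNgt => Fi.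
  by rewrite (max_idPl _) // oppr_le0.
by apply/prodf_neq0 => i _; rewrite gt_eqF // lt_max oppr_gt0 h orbT.
Qed.

Lemma excess_eq0 p : excess p = 0 <-> forall i, F i p <= 0.
Proof.
split=> [/eqP|h].
  rewrite psumr_eq0 => [/allP h i|i _]; last by rewrite le_max lexx.
  have /= /eqP <- := h i (mem_index_enum i).
  by rewrite le_max lexx orbT.
by rewrite /excess big1 // => i _; rewrite (max_idPl _).
Qed.

Lemma cutoff_neq0 p : cutoff p != 0 -> forall i, F i p < 0.
Proof.
move=> h; apply/depth_neq0; apply: contraNneq h => d0.
by rewrite /cutoff d0 mul0r.
Qed.

Lemma cutoff_01 p : 0 <= cutoff p <= 1.
Proof.
have d0 := depth_ge0 p; have e0 := excess_ge0 p.
have f0 : 0 <= defect p by exact: normr_ge0.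
rewrite /cutoff divr_ge0 ?addr_ge0 //=.
have := addr_ge0 (addr_ge0 d0 e0) f0; rewrite le_eqVlt => /predU1P[<-|s0].
  by rewrite invr0 mulr0.
by rewrite ler_pdivrMr // mul1r -addrA lerDl addr_ge0.
Qed.

Lemma cutoff_eq1 p : p.2 = p.1 *: T p -> (forall i, F i p < 0) -> cutoff p = 1.
Proof.
move=> pT pF; rewrite /cutoff /defect -pT subrr normr0.
rewrite (excess_eq0 p).2 => [|i]; last exact: ltW.
by rewrite !addr0 divff //; apply: (depth_neq0 p).2.
Qed.

Hypothesis no_boundary : forall p, cylinder X p -> p.2 = p.1 *: T p ->
  (forall i, F i p <= 0) -> \prod_(i < l) F i p != 0.

Lemma cutoff_denom_gt0 p : cylinder X p -> 0 < depth p + excess p + defect p.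
Proof.
move=> Cp; have d0 := depth_ge0 p; have e0 := excess_ge0 p.
have f0 : 0 <= defect p by exact: normr_ge0.
rewrite lt_neqAle !addr_ge0 // andbT eq_sym; apply/negP.
rewrite !paddr_eq0 ?addr_ge0 // -andbA => /and3P[dp /eqP ep].
rewrite normr_eq0 subr_eq0 => /eqP pT.
have pF := (excess_eq0 p).1 ep.
have /prodf_neq0 nz := no_boundary Cp pT pF.
suff : depth p != 0 by rewrite dp.
by apply/depth_neq0 => i; rewrite lt_neqAle nz ?pF.
Qed.

Hypothesis T_cont : {within cylinder X, continuous T}.
Hypothesis F_cont : forall i, {within cylinder X, continuous (F i)}.

Lemma cutoff_cvg p : cylinder X p ->
  cutoff q @[q --> within (cylinder X) (nbhs p)] --> cutoff p.
Proof.
move=> Cp; set G := within _ _.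
have Fc i : F i q @[q --> G] --> F i p.
  by have /subspace_continuousP/(_ _ Cp) := @F_cont i.
have Tc : T q @[q --> G] --> T p.
  by have /subspace_continuousP/(_ _ Cp) := T_cont.
have p1c : q.1 @[q --> G] --> p.1.
  by apply: cvg_within_filter; exact: cvg_fst.
have p2c : q.2 @[q --> G] --> p.2.
  by apply: cvg_within_filter; exact: cvg_snd.
have dc : depth q @[q --> G] --> depth p.
  apply: cvg_big => [|i _]; first exact: mul_continuous.
  by apply: cvg_max0; apply: cvgN.
have ec : excess q @[q --> G] --> excess p.
  apply: cvg_big => [|i _]; first exact: add_continuous.
  by apply: cvg_max0.
have fc : defect q @[q --> G] --> defect p.
  by apply: cvg_norm; apply: cvgB => //; apply: cvgZ.
apply: cvgM => //; apply: cvgV; first by rewrite gt_eqF ?cutoff_denom_gt0.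
by apply: cvgD => //; apply: cvgD.
Qed.
End Cutoff.

Theorem theorem2p8 (R : realType) (X : completeNormedModType R)
    (T : R * X -> X)
    (T_cont : {within cylinder X, continuous T})
    (T_compact : compact_operator T)
    (l : nat) (l_ge1 : (1 <= l)%N)
    (F : 'I_l -> R * X -> R) (F_assoc : T_association T F) :
  (exists x : X, T (1, x) = x) \/
  [set p : R * X | [/\ cylinder X p,
                       p.2 = p.1 *: T p,
                       \prod_(i < l) F i p = 0 &
                       forall i, F i p <= 0]] !=set0.
Proof.
have [_ F_cont F0 T_bnd] := F_assoc.
have [?|none] := pselect ([set p : R * X | [/\ cylinder X p,
  p.2 = p.1 *: T p, \prod_(i < l) F i p = 0 & forall i, F i p <= 0]] !=set0).
  by right.
left.
have no_boundary p : cylinder X p -> p.2 = p.1 *: T p ->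
    (forall i, F i p <= 0) -> \prod_(i < l) F i p != 0.
  by move=> Cp pT pF; apply/eqP => p0; apply: none; exists p.
pose phi := cutoff T F.
have [M M0 TM] : exists2 M : R, 0 < M &
    forall p, cylinder X p -> (forall i, F i p <= 0) -> `|T p| <= M.
  have [M M0 hM] := pinfty_ex_gt0 T_bnd; exists M => // p Cp pF.
  by apply: hM; exists p.
(* R^o is R as a module over itself, so that E is a vector space. *)
pose E : normedModType R := (R^o * X)%type.
pose C : set E := `[0, 1]%classic `*` [set x : X | `|x| <= M].
have C_cyl : C `<=` cylinder X by move=> p [p1 _]; split.
pose Phi (p : E) : E := (phi p, phi p *: T p).
have phi01 p : `[0, 1]%classic (phi p) by rewrite /= in_itv /= cutoff_01.
have C_bnd : bounded_set C.
  exists (Num.max 1 M); split=> [|N ltN p [p1 p2]]; first exact: num_real.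
  move: p1; rewrite /= in_itv /= => /andP[p1 p1'].
  rewrite prod_normE /= (le_trans _ (ltW ltN)) // ge_max.
  by rewrite ger0_norm // !le_max p1' p2 orbT.
have Tc := T_compact C C_cyl C_bnd.
have [||||||p Cp fixp] := @schauder R E C _ Phi.
- move=> x y t [x1 x2] [y1 y2] /andP[t0 t1]; split => /=.
    move: x1 y1; rewrite /= !in_itv /= => /andP[? ?] /andP[? ?].
    rewrite /GRing.scale /=; nra.
  rewrite (le_trans (ler_normD _ _)) // !normrZ.
  rewrite ger0_norm // ger0_norm ?subr_ge0 //.
  by move: x2 y2 => /=; nra.
- exists (0, 0); split=> /=; first by rewrite in_itv /= lexx ler01.
  by rewrite normr0 ltW.
- apply: closedI.
    by apply: preimage_closed => [p _|]; [exact: cvg_fst | exact: itv_closed].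
  apply: (@preimage_closed _ _ (fun p : E => `|p.2|) [set r | r <= M]).
    by move=> p _; apply: cvg_norm; exact: cvg_snd.
  exact: closed_le.
- apply: (continuous_subspaceW C_cyl); apply/subspace_continuousP => p Cp.
  have phic : phi q @[q --> within (cylinder X) (nbhs p)] --> phi p.
    exact: cutoff_cvg.
  have Tcp : T q @[q --> within (cylinder X) (nbhs p)] --> T p.
    by have /subspace_continuousP/(_ _ Cp) := T_cont.
  exact: (cvg_pair phic (cvgZ phic Tcp)).
- move=> p Cp; split=> /=; first exact: phi01.
  have [->|phi0] := eqVneq (phi p) 0.
    by rewrite scale0r normr0 ltW.
  have := phi01 p; rewrite /= in_itv /= => /andP[h0 h1].
  rewrite normrZ ger0_norm //.
  have : `|T p| <= M.
    by apply: TM; [exact: C_cyl | move=> i; exact/ltW/cutoff_neq0/phi0].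
  by have := normr_ge0 (T p); nra.
(* Phi maps C into the image under h of [0,1] x closure (T @` C), which is
   compact. *)
- pose h (q : R * X) : E := (q.1, q.1 *: q.2).
  have h_cont : continuous h.
    move=> q; exact: (cvg_pair cvg_fst (cvgZ cvg_fst cvg_snd)).
  have hK : compact (h @` (`[0, 1]%classic `*` closure (T @` C))).
    apply: continuous_compact; first exact: continuous_subspaceT.
    apply: compact_setX; first exact: segment_compact.
    by rewrite -precompactE.
  apply: precompact_subset (compact_precompact _ hK).
    move=> _ [p Cp <-]; exists (phi p, T p) => //; split=> /=.
      exact: phi01.
    by apply: subset_closure; exists p.
  exact: norm_hausdorff.
have p1 : p.1 = phi p by rewrite -{1}fixp.
have pT : p.2 = p.1 *: T p by rewrite p1 -{1}fixp.
(* Otherwise p would be the origin, where phi is 1. *)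
have phi_neq0 : phi p != 0.
  apply/eqP => phi0; have p0 : p = (0, 0).
    by rewrite -fixp /Phi phi0 scale0r.
  have : phi (0, 0) = 1 by apply: cutoff_eq1; rewrite /= ?scale0r.
  by rewrite -p0 phi0 => /eqP; rewrite eq_sym oner_eq0.
have phi1 : phi p = 1 by apply: cutoff_eq1 => //; exact: cutoff_neq0 phi_neq0.
exists p.2; rewrite {2}pT p1 phi1 scale1r; congr (T _).
by rewrite -phi1 -p1; case: (p).
Qed.
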